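(* For every integer $n>1$, the group $\mathbb{Z}^n$ is not a strongly CI$_f$-group.
   Context: For a group $G$ and a subset $S\subseteq G\setminus\{e\}$ with $S=S^{-1}$, the Cayley graph $\mathrm{Cay}(G;S)$ has vertex set $G$, with $g$ adjacent to $gs$ for all $g\in G$, $s\in S$. It is a CI-graph if whenever $S'\subseteq G\setminus\{e\}$, $S'=S'^{-1}$, and $\mathrm{Cay}(G;S)\cong\mathrm{Cay}(G;S')$ as graphs, there is a group automorphism $\alpha$ of $G$ with $\alpha(S)=S'$. A group $G$ is a strongly CI$_f$-group if every locally finite Cayley graph $\mathrm{Cay}(G;S)$ on $G$ (i.e. $S$ finite, not necessarily generating) is a CI-graph. *)

(* Defs.v *)
From mathcomp Require Import all_boot all_order all_algebra.
From mathcomp Require Import boolp classical_sets functions cardinality.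

Set Implicit Arguments.
Unset Strict Implicit.
Unset Printing Implicit Defensive.

Local Open Scope classical_set_scope.
Local Open Scope group_scope.

(* A simple graph on a possibly infinite vertex type V is represented by its
   adjacency relation V -> V -> Prop. *)
Definition graph_isomorphic (V W : Type)
    (E : V -> V -> Prop) (F : W -> W -> Prop) : Prop :=
  exists2 f : V -> W, bijective f & forall x y, E x y <-> F (f x) (f y).

Definition connection_set (G : groupType) (S : set G) : Prop :=
  ~ S 1 /\ [set s^-1 | s in S] = S.

Definition Cay (G : groupType) (S : set G) (g h : G) : Prop :=
  exists2 s, S s & h = g * s.

Definition is_CI_graph (G : groupType) (S : set G) : Prop :=
  forall S' : set G, connection_set S' ->
    graph_isomorphic (Cay S) (Cay S') ->
    exists2 alpha : {multiplicative G -> G}, bijective alpha & alpha @` S = S'.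

(* Cay S is regular of degree #|S|, hence locally finite iff S is finite. *)
Definition strongly_CIf_group (G : groupType) : Prop :=
  forall S : set G, connection_set S -> finite_set S -> is_CI_graph S.

(* Integer row vectors under addition: to_multiplicative turns a zmodType into
   a groupType, so that in Zn the operations *, 1, ^-1 are +, 0, -. *)
Definition Zn (n : nat) : groupType := Algebra.to_multiplicative 'rV[int]_n.

(* Main.v *)
Require Import Defs.
From mathcomp Require Import all_boot all_order all_algebra.
From mathcomp Require Import classical_sets cardinality.
From mathcomp Require Import zify.

(** A connection set need not generate, so a single element and its inverse
    already separate isomorphism of Cayley graphs from equivalence under
    automorphisms.
    In Z^n let e be a standard basis vector.  Both Cay {e, -e} and
    Cay {2e, -2e} are disjoint unions of two-way infinite paths, one for each
    coset of the subgroup generated by e or by 2e.  When n > 1 both subgroups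
    have infinite index, so both graphs have countably many components and are
    isomorphic ([Cay_pair_iso] applied to the explicit bijection [double_at]).
    But an automorphism sends e, which is not twice a vector, to a vector that
    is not twice a vector, so it cannot send {e, -e} to {2e, -2e}
    ([nonsquare_not_CIf]).  For n = 1 the argument breaks down because the two
    graphs have one and two components. *)

Set Implicit Arguments.
Unset Strict Implicit.
Unset Printing Implicit Defensive.

Section CyclicConnectionSets.

Local Open Scope classical_set_scope.
Local Open Scope group_scope.

Variable G : groupType.
Implicit Types s t g h : G.

Lemma connection_set_pair s : s != 1 -> connection_set [set s; s^-1].
Proof.
move=> s1; split; last by rewrite image_setU !image_set1 invgK setUC.
by case=> /esym/eqP; rewrite ?invg_eq1 (negPf s1).
Qed.

Lemma Cay_pairE s g h :
  Cay [set s; s^-1] g h <-> h = g * s \/ g = h * s.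
Proof.
split=> [[_ [->|->] ->]|[->|->]]; first by left.
- by right; rewrite mulgVK.
- by exists s => //; left.
- by exists s^-1; [right | rewrite mulgK].
Qed.

Lemma Cay_pair_iso s t (f : G -> G) :
  bijective f -> {morph f : x / x * s >-> x * t} ->
  graph_isomorphic (Cay [set s; s^-1]) (Cay [set t; t^-1]).
Proof.
move=> bij_f fM; exists f => // x y; rewrite !Cay_pairE -!fM.
by split=> -[]; [move=> ->; left | move=> ->; right
  | move/(bij_inj bij_f); left | move/(bij_inj bij_f); right].
Qed.

(** Being a square is invariant under automorphisms and inversion, so no
    automorphism carries {s, s^-1} onto {s^2, s^-2} when s is not a square.
    The bijection f nevertheless provides an isomorphism of their Cayley graphs;
    for s of infinite order, such an f exists as soon as the two graphs have
    equally many components. *)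
Lemma nonsquare_not_CIf s (f : G -> G) :
    (forall v, s <> v * v) -> s * s != 1 ->
    bijective f -> {morph f : x / x * s >-> x * (s * s)} ->
  ~ strongly_CIf_group G.
Proof.
move=> nsq ss1 bij_f fM CI.
have s1 : s != 1 by apply: contra_notN (nsq 1) => /eqP ->; rewrite mulg1.
have fin : finite_set [set s; s^-1].
  by rewrite finite_setU; split; exact: finite_set1.
have [alpha [beta alphaK betaK] im] := CI _ (connection_set_pair s1) fin _
  (connection_set_pair ss1) (Cay_pair_iso bij_f fM).
have : [set s * s; (s * s)^-1] (alpha s) by rewrite -im; exists s => //; left.
have pull t : alpha s = t * t -> False.
  move=> E; apply: (nsq (beta t)); apply: (can_inj alphaK).
  by rewrite gmulfM betaK.
by case=> [/pull //|]; rewrite invgM => /pull.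
Qed.

End CyclicConnectionSets.

Section Lattice.

Import GRing.Theory.
Local Open Scope ring_scope.

Variables (n : nat) (i : 'I_n).
Implicit Types x v : 'rV[int]_n.

Lemma delta_mx_not_double v : delta_mx 0 i <> v + v.
Proof. by move/rowP/(_ i); rewrite !mxE !eqxx /=; lia. Qed.

Lemma delta_mxD_neq0 : delta_mx 0 i + delta_mx 0 i != 0 :> 'rV[int]_n.
Proof. by apply/eqP => /rowP/(_ i); rewrite !mxE !eqxx. Qed.

Variable k : 'I_n.

(** On the coordinates (i, k) this is (a, b) |-> (2a + b mod 2, b div 2): the
    parity of b moves into the new i-th coordinate.  The lines b = 2c and
    b = 2c + 1 in direction i are stretched by a factor 2 and interleaved, as
    the even and the odd points of the line with k-th coordinate c. *)
Definition double_at x : 'rV[int]_n :=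
  \row_j if j == i then 2 * x 0%R i + (x 0%R k %% 2)%Z
         else if j == k then (x 0%R k %/ 2)%Z else x 0%R j.

Definition halve_at x : 'rV[int]_n :=
  \row_j if j == i then (x 0%R i %/ 2)%Z
         else if j == k then 2 * x 0%R k + (x 0%R i %% 2)%Z else x 0%R j.

Hypothesis ik : i != k.

Lemma double_at_bij : bijective double_at.
Proof.
have ki : (k == i) = false by rewrite eq_sym (negPf ik).
exists halve_at => x; apply/rowP => j; rewrite !mxE !eqxx ki;
  by case: eqVneq => [->|_]; [|case: eqVneq => [->|//]]; lia.
Qed.

Lemma double_atD x :
  double_at (x + delta_mx 0 i) =
  double_at x + (delta_mx 0 i + delta_mx 0 i).
Proof.
have ki : (k == i) = false by rewrite eq_sym (negPf ik).
apply/rowP => j; rewrite !mxE !eqxx ki /= addr0.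
by case: eqVneq => [_|_]; [|case: eqVneq => [_|_]]; lia.
Qed.

End Lattice.

Theorem corollary3p2 (n : nat) (hn : 1 < n) : ~ strongly_CIf_group (Zn n).
Proof.
have ik : Ordinal (ltnW hn) != Ordinal hn by [].
exact: (@nonsquare_not_CIf (Zn n) _ _ (@delta_mx_not_double _ _)
  (delta_mxD_neq0 _) (double_at_bij ik) (double_atD ik)).
Qed.
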